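(* The notion of a Ramsey algebra is not necessarily preserved under elementary equivalence: there exist infinite algebras $\mathcal{A}$ and $\mathcal{B}$ of the same language such that $\mathcal{A}\equiv\mathcal{B}$ (elementarily equivalent), $\mathcal{A}$ is a Ramsey algebra, and $\mathcal{B}$ is not a Ramsey algebra.
   Context: An algebra $\mathcal{A}=(A,\mathcal{F})$ consists of a set $A$ and a family $\mathcal{F}$ of finitary operations $f:A^n\to A$ on $A$; it is infinite if $A$ is infinite. When $\mathcal{L}$ is a set of function symbols (a purely functional language), an algebra of the language $\mathcal{L}$ is an $\mathcal{L}$-structure, $\mathcal{F}$ being the family of interpretations of the symbols; elementary equivalence is in the sense of first-order logic. An $n$-ary $f$ is an orderly composition of a family $\mathcal{G}$ of operations if there are a $k$-ary $g\in\mathcal{G}$ and $n_j$-ary $h_j\in\mathcal{G}$ ($1\le j\le k$) with $\sum_{j=1}^k n_j=n$ such that $f(x_1,\dots,x_n)=g(h_1(\bar x_1),\dots,h_k(\bar x_k))$, where $\bar x_1,\dots,\bar x_k$ are the consecutive blocks of $(x_1,\dots,x_n)$ of lengths $n_1,\dots,n_k$. The set $\mathrm{OT}(\mathcal{F})$ of orderly terms over $\mathcal{F}$ is the smallest collection of operations on $A$ that contains $\mathcal{F}\cup\{\mathrm{id}_A\}$ and is closed under orderly composition. For infinite sequences $\vec a,\vec b\in{}^\omega A$, $\vec a$ is a reduction of $\vec b$, written $\vec a\le_{\mathcal{F}}\vec b$, if there are orderly terms $f_j\in\mathrm{OT}(\mathcal{F})$ and finite subsequences $\vec b_j$ of $\vec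 b$ ($j\in\omega$) such that $\vec a(j)=f_j(\vec b_j)$ for every $j$ and the concatenation $\vec b_0*\vec b_1*\cdots$ is a subsequence of $\vec b$. Put $\mathrm{FR}_{\mathcal{F}}(\vec b)=\{\vec a(0):\vec a\le_{\mathcal{F}}\vec b\}$. The algebra $(A,\mathcal{F})$ is a Ramsey algebra if for every $\vec b\in{}^\omega A$ and every $X\subseteq A$ there is $\vec a\le_{\mathcal{F}}\vec b$ such that $\mathrm{FR}_{\mathcal{F}}(\vec a)$ is either contained in $X$ or disjoint from $X$. *)

(* Defs.v *)
From mathcomp Require Import all_boot.
From mathcomp Require Import boolp classical_sets cardinality.

Set Implicit Arguments.
Unset Strict Implicit.
Unset Printing Implicit Defensive.

Local Open Scope classical_set_scope.

Record language := Language { symbol : Type; arity : symbol -> nat }.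

Record structure (L : language) := Structure {
  carrier :> Type;
  interp : forall s : symbol L, (arity s).-tuple carrier -> carrier
}.

(* [term L n] and [formula L n] have their free variables among [n] de Bruijn
   indices; [Ex] binds index 0 and shifts the others. *)
Inductive term (L : language) (n : nat) :=
| Var of 'I_n
| App (s : symbol L) of 'I_(arity s) -> term L n.

Arguments App {L n} s _.

Inductive formula (L : language) : nat -> Type :=
| Eqn n of term L n & term L n : formula L n
| Not n of formula L n : formula L n
| And n of formula L n & formula L n : formula L n
| Ex n of formula L n.+1 : formula L n.

Fixpoint eval (L : language) (M : structure L) n (e : n.-tuple M)
    (t : term L n) : M :=
  match t with
  | Var i => tnth e i
  | App s ts => interp [tuple eval e (ts i) | i < arity s]
  end.

Fixpoint sat (L : language) (M : structure L) n (phi : formula L n) :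
    n.-tuple M -> Prop :=
  match phi with
  | Eqn _ t u => fun e => eval e t = eval e u
  | Not _ p => fun e => ~ sat p e
  | And _ p q => fun e => sat p e /\ sat q e
  | Ex _ p => fun e => exists x : M, sat p [tuple of x :: e]
  end.

Definition sentence (L : language) := formula L 0.

Definition models (L : language) (M : structure L) (phi : sentence L) : Prop :=
  sat phi ([tuple] : 0.-tuple M).

Definition elementarily_equivalent (L : language) (M N : structure L) : Prop :=
  forall phi : sentence L, models M phi <-> models N phi.

Record operation (A : Type) := Operation {
  op_arity : nat;
  op_fun :> op_arity.-tuple A -> A
}.

Definition id_op (A : Type) : operation A :=
  Operation (fun x : 1.-tuple A => thead x).

(* [xs] is the cutting of [x] into consecutive blocks of the arities of the
   [h j]; by the equation on arities every [x] has exactly one. *)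
Definition orderly_composition (A : Type) (G : set (operation A))
    (f : operation A) : Prop :=
  exists (g : operation A) (h : 'I_(op_arity g) -> operation A),
    [/\ G g, forall j, G (h j),
        op_arity f = \sum_(j < op_arity g) op_arity (h j) &
        forall (x : (op_arity f).-tuple A)
               (xs : forall j, (op_arity (h j)).-tuple A),
          x = flatten [seq tval (xs j) | j <- enum 'I_(op_arity g)] :> seq A ->
          f x = g [tuple h j (xs j) | j < op_arity g]].

Definition closed_orderly (A : Type) (G : set (operation A)) : Prop :=
  forall f, orderly_composition G f -> G f.

Definition OT (A : Type) (F : set (operation A)) : set (operation A) :=
  smallest (@closed_orderly A) (F `|` [set id_op A]).

(* The concatenation bs 0 ++ bs 1 ++ ... is a subsequence of [b]: each of its
   finite prefixes is an initial part of the subsequence b \o sigma. It is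
   finite when almost all blocks are empty, whence the formulation by prefixes.
   In particular each block is itself a finite subsequence of [b]. *)
Definition concat_subseq (A : Type) (bs : nat -> seq A) (b : nat -> A) : Prop :=
  exists2 sigma : nat -> nat, {homo sigma : i j / i < j} &
    forall N, let s := flatten (mkseq bs N) in s = mkseq (b \o sigma) (size s).

Definition reduction (A : Type) (F : set (operation A)) (a b : nat -> A) :
    Prop :=
  exists (f : nat -> operation A) (bs : forall j, (op_arity (f j)).-tuple A),
    [/\ forall j, OT F (f j), forall j, a j = f j (bs j) &
        concat_subseq (fun j => bs j) b].

Definition FR (A : Type) (F : set (operation A)) (b : nat -> A) : set A :=
  [set a 0 | a in [set a | reduction F a b]].

Definition Ramsey_algebra (A : Type) (F : set (operation A)) : Prop :=
  forall (b : nat -> A) (X : set A),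
    exists2 a, reduction F a b & FR F a `<=` X \/ FR F a `&` X = set0.

Definition operations (L : language) (M : structure L) : set (operation M) :=
  range (fun s : symbol L => Operation (@interp L M s)).
Arguments operations {L} M.

(* Main.v *)
Require Import Defs.
From mathcomp Require Import all_boot.
From mathcomp Require Import boolp classical_sets cardinality.

(* Take the language of unary symbols f_0, f_1, ... and the carrier consisting
   of a common fixed point of all f_s and of pairs {(i, true), (i, false)}.
   Each f_s collapses one pair to the point and swaps the two elements of every
   other pair. In A every pair is collapsed by some symbol, so every sequence
   reduces to the constant one at the fixed point; in B one pair is never
   collapsed, and the constant sequences in that pair have no homogeneous
   reduction. Finitely many symbols cannot tell a pair that is never collapsed
   from one collapsed by a later symbol, so all reducts of A and B to finite
   sublanguages are isomorphic. *)

Set Implicit Arguments.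
Unset Strict Implicit.
Unset Printing Implicit Defensive.

Local Open Scope classical_set_scope.

Section LocalIsomorphism.
Variables (L : language) (w : symbol L -> nat) (M N : structure L).

(** A homomorphism of reducts only: a formula has finitely many symbols, so ranking symbols by [w]
    confines it to the reduct below some [n]. *)
Definition hom_below (n : nat) (h : M -> N) : Prop :=
  forall s, w s < n -> forall x, h (interp (s := s) x) = interp (map_tuple h x).

Lemma hom_below_le m n h : m <= n -> hom_below n h -> hom_below m h.
Proof. by move=> mn hh s sm; apply: hh; apply: leq_trans mn. Qed.

Lemma eval_hom_below p (t : term L p) :
  exists n, forall h, hom_below n h ->
    forall e, h (eval e t) = eval (map_tuple h e) t.
Proof.
elim: t => [i|s ts IH]; first by exists 0 => h _ e /=; rewrite tnth_map.
have [b bP] := choice IH.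
(* The successor puts [s] itself strictly below the bound; the maximum over the finitely many
   arguments covers their symbols. *)
exists (maxn (w s).+1 (\max_(i < arity s) b i)) => h hh e /=.
rewrite (hh s) ?leq_maxl//; congr interp; apply: eq_from_tnth => i.
rewrite !(tnth_map, tnth_mktuple) bP//; apply: hom_below_le hh.
by apply: leq_trans (leq_maxr _ _); apply: leq_bigmax.
Qed.

(** The bound comes from [phi] alone. Injectivity of [h] reflects equations, and surjectivity pulls
    back existential witnesses. *)
Lemma sat_hom_below p (phi : formula L p) :
  exists n, forall h, hom_below n h -> bijective h ->
    forall e, sat phi e <-> sat phi (map_tuple h e).
Proof.
elim: phi => {p} [p t u|p phi [n IH]|p phi [n IH] psi [m IH']|p phi [n IH]].
- have [[n nP] [m mP]] := (eval_hom_below t, eval_hom_below u).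
  exists (maxn n m) => h hh hb e /=.
  rewrite -nP -?mP; [|exact: hom_below_le (leq_maxr n m) hh|].
    by split=> [->//|/(bij_inj hb)].
  exact: hom_below_le (leq_maxl n m) hh.
- by exists n => h hh hb e /=; have := IH h hh hb e; tauto.
- exists (maxn n m) => h hh hb e /=.
  have := IH h (hom_below_le (leq_maxl n m) hh) hb e.
  have := IH' h (hom_below_le (leq_maxr n m) hh) hb e.
  by tauto.
- exists n => h hh hb e /=; have [g _ gK] := hb.
  have consE x : map_tuple h [tuple of x :: e] = [tuple of h x :: map_tuple h e].
    exact: val_inj.
  split=> -[x].
    by move=> /(IH _ hh hb); rewrite consE; exists (h x).
  by rewrite -[x]gK -consE => /(IH _ hh hb); exists (g x).
Qed.

Lemma elementarily_equivalent_local :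
  (forall n, exists2 h, hom_below n h & bijective h) ->
  elementarily_equivalent M N.
Proof.
move=> isoMN phi; have [n nP] := sat_hom_below phi.
have [h hh hb] := isoMN n.
by have := nP h hh hb [tuple]; rewrite [map_tuple h _]tuple0.
Qed.

End LocalIsomorphism.

Section OrderlyTerms.
Variables (A : Type) (F : set (operation A)).

Definition preserves (S : pred A) (f : operation A) : Prop :=
  forall x : (op_arity f).-tuple A, all S x -> S (f x).

Lemma all_flatten (S : pred A) (ss : seq (seq A)) :
  all S (flatten ss) = all (all S) ss.
Proof. by elim: ss => //= s ss <-; rewrite all_cat. Qed.

(** [orderly_composition] gives the value at [x] only relative to a cutting of [x], so evaluating it
    requires producing one. *)
Lemma tuple_blocks k (d : 'I_k -> nat) (x : seq A) :
  size x = \sum_(j < k) d j ->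
  exists xs : forall j, (d j).-tuple A,
    x = flatten [seq tval (xs j) | j <- enum 'I_k].
Proof.
move=> sx; pose sh := [seq d j | j <- enum 'I_k].
have sumsh : sumn sh = size x by rewrite sx sumnE big_map big_enum.
have shapeE : shape (reshape sh x) = sh by rewrite reshapeKl ?sumsh.
have szr : size (reshape sh x) = k by rewrite size_reshape size_map size_enum_ord.
have szP (j : 'I_k) : size (nth [::] (reshape sh x) j) == d j.
  rewrite -(nth_map _ 0) ?szr// -/(shape _) shapeE (nth_map j) ?size_enum_ord//.
  by rewrite nth_ord_enum.
exists (fun j => Tuple (szP j)).
rewrite /= (map_comp (nth [::] _) val) val_enum_ord -[X in iota _ X]szr.
by rewrite -/(mkseq _ _) mkseq_nth reshapeKr ?sumsh.
Qed.

(** Preservation of [S] holds for the identity and passes to orderly compositions, since each block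
    of a tuple in [S] is again in [S]; minimality of [OT F] does the rest. *)
Lemma OT_preserves (S : pred A) (f : operation A) :
  (forall g, F g -> preserves S g) -> OT F f -> preserves S f.
Proof.
move=> FS; apply: (smallest_sub (X := preserves S)) => [{}f|g [/FS//|->]].
- move=> [g [h [gS hS fE fP]]] x xS.
  have [xs xE] := @tuple_blocks _ _ x (etrans (size_tuple x) fE).
  rewrite (fP x xs xE); apply: gS.
  move: xS; rewrite xE all_flatten !all_map => xsS.
  by apply: sub_all xsS => j; apply: hS.
- by move=> x /all_tnthP xS; apply: xS.
Qed.

(** The blocks of length one concatenate to [b] itself. *)
Lemma reduction_pointwise (g : nat -> 1.-tuple A -> A) (b : nat -> A) :
  (forall j, OT F (Operation (g j))) ->
  reduction F (fun j => g j [tuple b j]) b.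
Proof.
move=> gP; exists (fun j => Operation (g j)), (fun j => [tuple b j]).
split=> //; exists id => // N /=.
have -> : flatten (mkseq (fun j => [:: b j]) N) = mkseq b N.
  by rewrite /mkseq (map_comp (fun x => [:: x]) b) flatten_seq1.
by rewrite size_mkseq.
Qed.

Lemma reduction_preserves (S : pred A) (a b : nat -> A) :
  (forall g, F g -> preserves S g) -> (forall j, S (b j)) ->
  reduction F a b -> forall j, S (a j).
Proof.
move=> FS bS [f [bs [fF aE [sigma _ bsE]]]] j.
rewrite aE; apply: OT_preserves (fF j) _ _ => //.
(* Block [j] ends the concatenation of the first [j.+1] blocks, whose entries are all values of
   [b]. *)
have : all S (flatten (mkseq (fun j => bs j : seq A) j.+1)).
  by rewrite bsE all_map; apply/allP => i _; apply: bS.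
by rewrite all_flatten mkseqS all_rcons => /andP[].
Qed.

End OrderlyTerms.

Definition swap_language : language := Language (fun _ : nat => 1).

Definition swap (i : nat) (x : option (nat * bool)) : option (nat * bool) :=
  if x is Some (j, c) then if j == i then None else Some (j, ~~ c) else None.

(* The pairs below [k] are never collapsed: the algebras A and B are the cases
   [k = 0] and [k = 1]. *)
Definition swap_structure (k : nat) : structure swap_language :=
  @Structure swap_language (option (nat * bool))
    (fun s x => swap (s + k) (thead x)).

Lemma swap_structure_infinite k : infinite_set [set: swap_structure k].
Proof.
pose index (x : option (nat * bool)) := if x is Some (i, _) then i else 0.
move=> /(finite_image index); apply: contra_not infinite_nat.
by apply: sub_finite_set => i _; exists (Some (i, true)).
Qed.

(* A cyclic permutation of the pairs [0, ..., n] is an isomorphism for the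
   symbols below [n]. *)
Lemma swap_structure_equivalent :
  elementarily_equivalent (swap_structure 1) (swap_structure 0).
Proof.
apply: (@elementarily_equivalent_local swap_language id) => n.
(* Symbol [s] collapses pair [s.+1] in the source and pair [s] in the target, hence the shift down.
   Pair 0, never collapsed in the source, goes to pair [n], which no symbol below [n] collapses. *)
pose f i := if i is j.+1 then if j < n then j else i else n.
pose g i := if i < n then i.+1 else if i == n then 0 else i.
have fK : cancel f g.
  move=> [|i]; rewrite /f /g ?ltnn ?eqxx//.
  case: (ltnP i n) => [->//|ni]; rewrite ltnNge ltnW//=.
  by rewrite gtn_eqF.
have gK : cancel g f.
  move=> i; rewrite /f /g; case: (ltnP i n) => [->//|].
  rewrite leq_eqVlt eq_sym; case: eqP => [->//|_ /=].
  by case: i => // i; rewrite ltnS => /leq_gtF->.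
have fE i s : s < n -> (f i == s) = (i == s.+1).
  by move=> sn; rewrite (can2_eq fK gK) /g sn.
pose h (u : nat -> nat) : option (nat * bool) -> option (nat * bool) :=
  omap (fun x => (u x.1, x.2)).
have hK u v : cancel u v -> cancel (h u) (h v).
  by move=> uK [[i c]|] //=; rewrite uK.
exists (h f); last by exists (h g); apply: hK.
move=> s sn x; case/tupleP: x => -[[i c]|] x; rewrite //=.
by rewrite addn0 addn1 fE//; case: eqP.
Qed.

Lemma operations_swap k (g : operation (swap_structure k)) :
  operations (swap_structure k) g ->
  exists s, g = Operation (fun x : 1.-tuple (swap_structure k) =>
                             swap (s + k) (thead x)).
Proof. by move=> [s _ <-]; exists s. Qed.

Lemma OT_swap k s :
  OT (operations (swap_structure k))
     (Operation (fun x : 1.-tuple (swap_structure k) =>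
                   swap (s + k) (thead x))).
Proof. by apply: sub_gen_smallest; left; exists s. Qed.

Lemma swap_structure_Ramsey : Ramsey_algebra (operations (swap_structure 0)).
Proof.
move=> b X; set F := operations _.
have noneF g : F g -> preserves (fun x => x == None) g.
  move=> /operations_swap[s ->] x; case/tupleP: x => x x'.
  by move=> /= /andP[/eqP-> _].
exists (fun=> None).
  (* Each term of [b] is hit by the symbol collapsing its own pair; for [None] any symbol works, and
     0 is the default. *)
  have := @reduction_pointwise _ F
    (fun j x => swap ((if b j is Some (i, _) then i else 0) + 0) (thead x)) b.
  rewrite (_ : (fun j => _) = fun=> None).
    by apply=> j; apply: OT_swap.
  by apply/funext => j; case: (b j) => [[i c]|//]; rewrite /= addn0 eqxx.
have FRN : FR F (fun=> None) `<=` [set None].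
  move=> _ [a aF <-]; apply/eqP.
  exact: (reduction_preserves (S := fun x => x == None) _ _ aF).
have [XN|XN] := pselect (X None); [left|right].
- by move=> x /FRN ->.
- by apply/seteqP; split=> // x [/FRN ->].
Qed.

Lemma swap_structure_not_Ramsey :
  ~ Ramsey_algebra (operations (swap_structure 1)).
Proof.
set F := operations _.
move=> /(_ (fun=> Some (0, true)) [set Some (0, true)])[a aF aX].
(* Pair 0 is closed under all operations, so [a] stays in it. Then [FR F a] contains both [a 0] and
   its swap, that is, the whole pair, of which exactly one element lies in the chosen set. *)
pose S (x : option (nat * bool)) := if x is Some (i, _) then i == 0 else false.
have FS g : F g -> preserves S g.
  move=> /operations_swap[s ->] x; case/tupleP: x => -[[i c]|] x' //=.
  by move=> /andP[/eqP-> _]; rewrite addn1.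
have := reduction_preserves FS _ aF 0 => /(_ (fun=> erefl)).
have a0 : FR F a (a 0).
  exists a => //; have := @reduction_pointwise _ F (fun _ x => thead x) a.
  by apply => j; apply: sub_gen_smallest; right.
(* [swap 1] interprets symbol 0 and exchanges the two elements of pair 0. *)
have a1 : FR F a (swap 1 (a 0)).
  exists (fun j => swap 1 (a j)) => //.
  have := @reduction_pointwise _ F (fun _ x => swap (0 + 1) (thead x)) a.
  by apply => j; apply: OT_swap.
case: (a 0) a0 a1 => [[i c]|//] a0 a1 /eqP i0; rewrite {}i0 /= in a0 a1.
case: aX => [aX|aX].
- by have := aX _ a0; have := aX _ a1; case: c {a0 a1}.
- suff : set0 (Some (0, true)) by [].
  by rewrite -aX; case: c a0 a1.
Qed.

Theorem corollary4p5 :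
  exists (L : language) (A B : structure L),
    infinite_set [set: A] /\ infinite_set [set: B] /\
    elementarily_equivalent A B /\
    Ramsey_algebra (operations A) /\
    ~ Ramsey_algebra (operations B).
Proof.
exists swap_language, (swap_structure 0), (swap_structure 1).
split; first exact: swap_structure_infinite.
split; first exact: swap_structure_infinite.
split; first by move=> phi; split=> /swap_structure_equivalent.
split; [exact: swap_structure_Ramsey|exact: swap_structure_not_Ramsey].
Qed.
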